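(* Let $n\geq m\geq 1$ and $0\leq k\leq n$ be integers. Then $$\alpha_k(S/I_{n,m})=\binom{n-k+1,\;m}{k},$$ where $\binom{n-k+1,\;m}{k}$ is the coefficient of $x^k$ in the expansion of $(1+x+\cdots+x^{m-1})^{n-k+1}$. In particular, $$\alpha_k(I_{n,m})=\binom{n}{k}-\binom{n-k+1,\;m}{k}.$$
   Context: $K$ is a field, $S=K[x_1,\ldots,x_n]$, and $$I_{n,m}=(x_1x_2\cdots x_m,\;x_2x_3\cdots x_{m+1},\;\ldots,\;x_{n-m+1}\cdots x_n)\subset S$$ is the $m$-path ideal of the path graph with $n$ vertices. For squarefree monomial ideals $I\subset J\subset S$ (with $J=S$ or $I=0$ allowed) and $0\leq k\leq n$, $\alpha_k(J/I)$ denotes the number of squarefree monomials of degree $k$ that belong to $J\setminus I$. Thus $\alpha_k(S/I_{n,m})$ counts the squarefree monomials of degree $k$ not in $I_{n,m}$, and $\alpha_k(I_{n,m})$ those in $I_{n,m}$. *)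

(* Defs.v *)
From mathcomp Require Import all_boot all_algebra.
From mathcomp Require Import boolp.
From mathcomp Require Import mpoly.

Set Implicit Arguments.
Unset Strict Implicit.
Unset Printing Implicit Defensive.

Import GRing.Theory.
Local Open Scope ring_scope.

Definition ideal_span (A : comNzRingType) (r : nat) (g : 'I_r -> A) : {pred A} :=
  fun p => `[< exists c : 'I_r -> A, p = \sum_(i < r) c i * g i >].

(* With 0-based variables 'X_0, ..., 'X_(n - 1), the generator of index i is
   'X_i * ... * 'X_(i + m - 1), for i = 0, ..., n - m.  Only meaningful for
   m <= n: otherwise n - m is truncated to 0. *)
Definition path_gen (K : fieldType) (n m : nat) (i : 'I_(n - m + 1)) :
    {mpoly K[n]} :=
  \prod_(j < n | (i <= j < i + m)%N) 'X_j.

Arguments path_gen : clear implicits.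

Definition path_ideal (K : fieldType) (n m : nat) : {pred {mpoly K[n]}} :=
  ideal_span (path_gen K n m).

Definition zero_ideal (K : fieldType) (n : nat) : {pred {mpoly K[n]}} := pred1 0.

Definition unit_ideal (K : fieldType) (n : nat) : {pred {mpoly K[n]}} := predT.

Definition squarefree_mon (n : nat) (u : 'X_{1..n}) : bool :=
  [forall i, (u i <= 1)%N].

Arguments path_ideal : clear implicits.
Arguments zero_ideal : clear implicits.
Arguments unit_ideal : clear implicits.

(* alpha k J I is alpha_k(J/I).  The bound k.+1 on the degree makes the type of
   monomials finite and excludes no monomial of degree k. *)
Definition alpha (K : fieldType) (n k : nat) (J I : {pred {mpoly K[n]}}) : nat :=
  #|[set u : 'X_{1..n < k.+1} |
      [&& squarefree_mon u, mdeg u == k,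
          'X_[K, u] \in J & 'X_[K, u] \notin I]]|.

(* The coefficient of 'X^k in (1 + 'X + ... + 'X^(m - 1)) ^ N. *)
Definition ext_binomial (N m k : nat) : nat :=
  (((\sum_(i < m) 'X^i) ^+ N : {poly nat})`_k)%R.

(* Main.v *)
Require Import Defs.
From mathcomp Require Import all_boot all_algebra.
From mathcomp Require Import zify boolp.
From mathcomp Require Import mpoly.

(* A squarefree monomial of degree k is a binary word with k ones, and it lies
   outside the path ideal iff the word has no m consecutive ones.  Reading off
   the runs of ones between the n - k zeros turns such a word into a sequence of
   n - k + 1 lengths, all smaller than m, with sum k. *)

Import GRing.Theory.

Lemma cat_nseq_cons (T : Type) (r : nat) (x : T) (s : seq T) :
  nseq r.+1 x ++ s = nseq r x ++ x :: s.
Proof. by elim: r => //= r ->. Qed.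

Definition all_on (s : seq bool) (i m : nat) : Prop :=
  i + m <= size s /\ forall j, i <= j < i + m -> nth false s j.

(* The word w, preceded by r ones, has no m consecutive ones. *)
Fixpoint short_runs (m r : nat) (w : seq bool) : bool :=
  match w with
  | [::] => r < m
  | true :: w' => short_runs m r.+1 w'
  | false :: w' => (r < m) && short_runs m 0 w'
  end.

(** Induction on [w] for all [r]. A leading one joins the prefix of ones; at a leading zero, a
    window of [m] ones either fits in the prefix or starts after the zero. *)
Lemma short_runsPn (m r : nat) (w : seq bool) : 0 < m ->
  reflect (exists i, all_on (nseq r true ++ w) i m) (~~ short_runs m r w).
Proof.
move=> m0; apply: (iffP idP).
- elim: w r => [|[] w IH] r /=.
  + rewrite -leqNgt cats0 => le_mr; exists 0; split; first by rewrite size_nseq.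
    by move=> j hj; rewrite nth_nseq; case: ifP => //; lia.
  + by move=> /IH; rewrite cat_nseq_cons.
  + rewrite negb_and -leqNgt => /orP[le_mr|/IH[i [/= szi onei]]].
      exists 0; split; first by rewrite size_cat size_nseq; lia.
      move=> j hj; rewrite nth_cat size_nseq nth_nseq.
      by have -> : j < r by lia.
    (* The shift by [r.+1] skips the prefix of ones and the zero that closes it. *)
    exists (r + i.+1); split; first by rewrite size_cat size_nseq /=; lia.
    move=> j hj; rewrite nth_cat size_nseq.
    have -> : (j < r) = false by lia.
    have -> : j - r = (j - r.+1).+1 by lia.
    by apply: onei; lia.
- elim: w r => [|[] w IH] r /=.
  + by rewrite cats0 => -[i []]; rewrite size_nseq; lia.
  + by move=> H; apply: IH; rewrite cat_nseq_cons.
  + move=> [i [szi onei]]; rewrite negb_and -leqNgt.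
    have [//|lt_rm] /= := leqP m r; apply: (IH 0).
    rewrite size_cat size_nseq /= in szi.
    (* As [r < m], a window starting at or before position [r] would cover the zero there. *)
    have ri : r < i.
      rewrite ltnNge; apply/negP => le_ir.
      have /onei : i <= r < i + m by lia.
      by rewrite nth_cat size_nseq ltnn subnn.
    exists (i - r.+1); split => /=; first by lia.
    move=> j hj; have /onei : i <= j + r.+1 < i + m by lia.
    rewrite nth_cat size_nseq.
    have -> : (j + r.+1 < r) = false by lia.
    by have -> : j + r.+1 - r = j.+1 by lia.
Qed.

(** [P] lives on sequences so that it makes sense at both lengths, as inductions on the word
    need. *)
Lemma card_tupleS (n : nat) (P : pred (seq bool)) :
  #|[set t : n.+1.-tuple bool | P t]| =
  #|[set t : n.-tuple bool | P (true :: t)]| +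
  #|[set t : n.-tuple bool | P (false :: t)]|.
Proof.
rewrite !cardsE -!sum1_card.
rewrite (reindex (fun p : bool * n.-tuple bool => [tuple of p.1 :: p.2])) /=.
  rewrite -(pair_big_dep xpredT (fun b (t : n.-tuple bool) => P (b :: t))
            (fun _ _ => 1)) /=.
  by rewrite big_bool.
exists (fun t : n.+1.-tuple bool => (thead t, [tuple of behead t])).
  by move=> [b t] _ /=; congr pair; apply/val_inj.
by move=> t _; rewrite [in RHS](tuple_eta t).
Qed.

Lemma card_tuple0 (P : pred (seq bool)) :
  #|[set t : 0.-tuple bool | P t]| = P [::].
Proof.
rewrite cardsE; case: (boolP (P [::])) => h.
  rewrite (eq_card (B := predT)) ?card_tuple ?expn0 //.
  by move=> t; rewrite !inE tuple0.
by apply: eq_card0 => t; rewrite !inE tuple0; apply: negbTE.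
Qed.

Lemma card_count_tuple (n k : nat) :
  #|[set t : n.-tuple bool | count id t == k]| = 'C(n, k).
Proof.
elim: n k => [|n IH] k.
  by rewrite (card_tuple0 (fun t => count id t == k)) bin0n /= eq_sym.
rewrite (card_tupleS _ (fun t => count id t == k)) /=; case: k => [|k].
  rewrite IH !bin0 -[RHS]add0n; congr addn.
  by apply: eq_card0 => t; rewrite inE.
rewrite binS addnC -!IH; congr addn.
Qed.

Local Open Scope ring_scope.

Lemma sum_polyXS (m : nat) :
  \sum_(i < m.+1) 'X^i = 1 + 'X * \sum_(i < m) 'X^i :> {poly nat}.
Proof.
rewrite big_ord_recl expr0 big_distrr /=; congr (_ + _).
by apply: eq_bigr => i _; rewrite -exprS.
Qed.

(** [N] is the number of zeros. The first factor counts the ones still to be added to the current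
    run, which already has [r]; each zero opens a fresh run, with a full factor. If [m <= r],
    truncated subtraction makes the first factor an empty sum. *)
Lemma card_short_runs (n m r N k : nat) : n = (N + k)%N ->
  #|[set t : n.-tuple bool | (count id t == k) && short_runs m r t]| =
  ((\sum_(i < m - r) 'X^i) * (\sum_(i < m) 'X^i) ^+ N : {poly nat})`_k.
Proof.
elim: n r N k => [|n IH] r N k nNk.
  have [-> ->] : N = 0%N /\ k = 0%N by lia.
  rewrite (card_tuple0 (fun t => (count id t == 0%N) && short_runs m r t)) /=.
  rewrite expr0 mulr1 -subn_gt0; case: (m - r)%N => [|d].
    by rewrite big_ord0 coef0.
  by rewrite sum_polyXS coefD coefXM coef1.
rewrite (card_tupleS _ (fun t => (count id t == k) && short_runs m r t)) /=.
(* The constant term stands for a zero closing the current run, the multiple of ['X] for a one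
   extending it. *)
have -> : \sum_(i < m - r) 'X^i =
    (r < m)%:R + 'X * \sum_(i < m - r.+1) 'X^i :> {poly nat}.
  case: ltnP => [lt_rm|le_mr].
    by rewrite -sum_polyXS; have -> : (m - r = (m - r.+1).+1)%N by lia.
  have [-> ->] : (m - r = 0)%N /\ (m - r.+1 = 0)%N by lia.
  by rewrite big_ord0 mulr0 addr0.
rewrite mulrDl coefD -mulrA coefXM addrC; congr addn.
- case: k nNk => [|k] nNk /=.
    by apply: eq_card0 => t; rewrite inE.
  by rewrite -IH //; lia.
(* With no zero available, [k = n.+1] exceeds the length [n] of the tail, so no word starts with a
   zero; the coefficient of a constant at [k > 0] vanishes too. *)
- case: N nNk => [|N] nNk.
    rewrite expr0 mulr1 eq_card0 => [|t].
      by case: ltnP => _; rewrite ?coef0 // coef1; case: k nNk.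
    rewrite inE; have := count_size id t; rewrite size_tuple => le_tn.
    by rewrite add0n -[k]add0n -nNk ltn_eqF // ltnS.
  case: ltnP => _; last first.
    by rewrite mul0r coef0 eq_card0 // => t; rewrite inE andbF.
  (* After the zero the run length is 0, so the first factor becomes full and supplies the missing
     power. *)
  have := IH 0%N N k; rewrite subn0 -exprS mul1r; apply.
  by apply: succn_inj; rewrite nNk addSn.
Qed.

(** Compare coefficients at [u]: it is 1 on the left, and 0 in every multiple of a monomial that
    does not divide ['X_[u]]. Conversely, ['X_[u - g i]] is the cofactor. *)
Lemma mpolyX_in_span (K : fieldType) (n r : nat) (g : 'I_r -> 'X_{1..n})
    (u : 'X_{1..n}) :
  ('X_[K, u] \in ideal_span (fun i => 'X_[K, g i])) = [exists i, (g i <= u)%MM].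
Proof.
apply/asboolP/existsP => [[c Xu]|[i le_iu]].
  apply/existsP; apply: contraT; rewrite negb_exists => /forallP gNu.
  have := congr1 (mcoeff u) Xu.
  rewrite mcoeffX eqxx raddf_sum big1 => [/eqP|i _]; first by rewrite oner_eq0.
  apply: memN_msupp_eq0; rewrite (perm_mem (msuppMX _ _)).
  apply/negP => /mapP[v _ u_gv].
  by have := gNu i; rewrite u_gv lem_addr.
exists (fun j => if j == i then 'X_[u - g i] else 0).
rewrite (bigD1 i) //= eqxx -mpolyXD submK // big1 ?addr0 // => j /negbTE ->.
by rewrite mul0r.
Qed.

Local Open Scope nat_scope.

(** Only the support is recorded, which determines a squarefree monomial. *)
Definition word_of_mon {n : nat} (u : 'X_{1..n}) : n.-tuple bool :=
  [tuple 0 < u i | i < n].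

Lemma nth_word_of_mon (n : nat) (u : 'X_{1..n}) (j : 'I_n) :
  nth false (word_of_mon u) j = (0 < u j).
Proof. by rewrite -tnth_nth tnth_mktuple. Qed.

Lemma mem_path_ideal (K : fieldType) (n m : nat) (u : 'X_{1..n}) :
  0 < m -> m <= n ->
  ('X_[K, u] \in path_ideal K n m) = ~~ short_runs m 0 (word_of_mon u).
Proof.
move=> m0 le_mn.
(* The exponent vector of a generator is the indicator of its window, so divisibility only asks [u]
   to be positive there. *)
pose g (i : 'I_(n - m + 1)) : 'X_{1..n} :=
  (\sum_(j < n | (i <= j < i + m)%N) U_(j))%MM.
have gE i l : g i l = (i <= l < i + m).
  rewrite mnm_sumE big_mkcond (bigD1 l) //= mnm1E eqxx big1 ?addn0.
    by case: ifP.
  by move=> j jl; rewrite mnm1E (negbTE jl); case: ifP.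
have -> : path_ideal K n m = ideal_span (fun i => 'X_[K, g i]).
  by congr ideal_span; apply: funext => i; rewrite /path_gen mprodXE.
rewrite mpolyX_in_span; apply/existsP/short_runsPn => // -[i].
  move=> /mnm_lepP le_gu; exists i; split.
    by rewrite size_tuple; have := ltn_ord i; lia.
  move=> j hj; have lt_jn : j < n by have := ltn_ord i; lia.
  have := le_gu (Ordinal lt_jn).
  by rewrite gE /= hj (nth_word_of_mon _ u (Ordinal lt_jn)).
rewrite /all_on size_tuple => -[le_imn one].
have lt_i : i < n - m + 1 by lia.
exists (Ordinal lt_i); apply/mnm_lepP => j; rewrite gE /=.
case: (boolP (i <= j < i + m)) => // hj.
by have := one j hj; rewrite /= nth_word_of_mon => ->.
Qed.

(** For exponents 0 and 1, [word_of_mon] is a bijection onto words, turning the degree into the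
    number of ones. *)
Lemma card_squarefree_mon (n k : nat) (P : pred (seq bool)) :
  #|[set u : 'X_{1..n < k.+1} |
      [&& squarefree_mon u, mdeg u == k & P (word_of_mon u)]]| =
  #|[set t : n.-tuple bool | (count id t == k) && P t]|.
Proof.
have count_sum (t : n.-tuple bool) : count id t = \sum_(i < n) tnth t i.
  rewrite -sum1_count big_tuple big_mkcond; apply: eq_bigr => i _.
  by case: (tnth t i).
rewrite -(card_in_imset (f := fun u : 'X_{1..n < k.+1} => word_of_mon u)).
  congr #|pred_of_set _|; apply/setP => t; apply/imsetP/idP => [[u]|].
    rewrite !inE => /and3P[/forallP sf /eqP degu Pu] ->; rewrite Pu andbT.
    apply/eqP; apply: etrans degu; rewrite mdegE count_sum.
    apply: eq_bigr => i _.
    by rewrite tnth_mktuple; have := sf i; case: (u i) => [|[]].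
  rewrite !inE => /andP[/eqP count_t Pt].
  pose u : 'X_{1..n} := [multinom nat_of_bool (tnth t i) | i < n].
  have degu : mdeg u = k.
    by rewrite mdegE -count_t count_sum; apply: eq_bigr => i _; rewrite mnmE.
  have wu : word_of_mon u = t.
    apply: eq_from_tnth => i; rewrite tnth_mktuple mnmE.
    by case: (tnth t i).
  have lt_u : mdeg u < k.+1 by rewrite degu.
  exists (BMultinom lt_u); last by rewrite /= wu.
  rewrite inE wu Pt degu eqxx !andbT; apply/forallP => i.
  by rewrite mnmE leq_b1.
move=> u v; rewrite !inE => /andP[/forallP sfu _] /andP[/forallP sfv _] wuv.
apply/val_inj/mnmP => i /=; have := congr1 (fun t => tnth t i) wuv.
rewrite !tnth_mktuple; have := sfu i; have := sfv i.
by case: (u i) => [|[]] //; case: (v i) => [|[]].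
Qed.

Theorem proposition3p1 (K : fieldType) (n m k : nat) :
  (1 <= m)%N -> (m <= n)%N -> (k <= n)%N ->
  alpha k (unit_ideal K n) (path_ideal K n m)
    = ext_binomial (n - k + 1) m k
  /\ ((alpha k (path_ideal K n m) (zero_ideal K n))%:Z
      = 'C(n, k)%:Z - (ext_binomial (n - k + 1) m k)%:Z)%R.
Proof.
move=> m0 le_mn le_kn.
have quotE : alpha k (unit_ideal K n) (path_ideal K n m) =
    #|[set t : n.-tuple bool | (count id t == k) && short_runs m 0 t]|.
  rewrite -card_squarefree_mon; congr #|pred_of_set _|; apply/setP => u.
  by rewrite !inE mem_path_ideal // negbK.
have idealE : alpha k (path_ideal K n m) (zero_ideal K n) =
    #|[set t : n.-tuple bool | (count id t == k) && ~~ short_runs m 0 t]|.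
  rewrite -(card_squarefree_mon n k (fun w => ~~ short_runs m 0 w)).
  congr #|pred_of_set _|; apply/setP => u.
  rewrite !inE mem_path_ideal //.
  by rewrite -msupp_eq0 msuppX andbT.
have extE : alpha k (unit_ideal K n) (path_ideal K n m) =
    ext_binomial (n - k + 1) m k.
  (* There are [n - k] zeros; the run before the first zero gives the extra factor. *)
  rewrite quotE (card_short_runs _ _ _ (n - k)); last by rewrite subnK.
  by rewrite subn0 -exprS /ext_binomial addn1.
split=> //; apply/eqP; rewrite eq_sym subr_eq -extE quotE idealE -PoszD.
(* Words with [k] ones are split by [short_runs] into the two counts. *)
rewrite -card_count_tuple -(cardsID [set t : n.-tuple bool | short_runs m 0 t]).
apply/eqP; congr Posz; rewrite addnC; congr addn; apply: eq_card => t.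
  by rewrite !inE andbC.
by rewrite !inE.
Qed.
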